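(* Let $F$ be a field, let $n\geq 2$ be an integer, and let $M_{n}(F)$ be the ring of $n\times n$ matrices over $F$. Then: (1) $\overrightarrow{\Gamma}_{E}(M_{n}(F))$ is connected, and $\mathrm{Diam}(\overrightarrow{\Gamma}_{E}(M_{n}(F)))=\mathrm{Girth}(\overrightarrow{\Gamma}_{E}(M_{n}(F)))=2$. (2) $\overrightarrow{\mathrm{AG}}(M_{n}(F))$ is connected, and $\mathrm{Diam}(\overrightarrow{\mathrm{AG}}(M_{n}(F)))=\mathrm{Girth}(\overrightarrow{\mathrm{AG}}(M_{n}(F)))=2$.
   Context: For a ring $R$ and $A\subseteq R$, $A^{*}=A\setminus\{0\}$. An element $x\in R$ is a left (resp. right) zero divisor if $xy=0$ (resp. $yx=0$) for some $y\in R^{*}$; $Z(R)$ is the set of all elements that are left or right zero divisors. For $x\in R$, $\mathrm{Ann}_{l}(x)=\{s\in R: sx=0\}$ and $\mathrm{Ann}_{r}(x)=\{s\in R: xs=0\}$. All digraphs are simple (no loops, no multiple arcs). The extended zero-divisor digraph $\overrightarrow{\Gamma}_{E}(R)$ has vertex set $Z(R)^{*}$, and for distinct $x,y\in Z(R)^{*}$, $x\to y$ is an arc iff $x^{k}y^{m}=0$ for some positive integers $k,m$ with $x^{k}\neq 0$ and $y^{m}\neq 0$. The annihilator digraph $\overrightarrow{\mathrm{AG}}(R)$ has vertex set $Z(R)^{*}$, and for distinct $x,y\in Z(R)^{*}$, $x\to y$ is an arc iff $\mathrm{Ann}_{l}(xy)\setminus(\mathrm{Ann}_{l}(x)\cup\mathrm{Ann}_{l}(y))\neq\emptyset$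 or $\mathrm{Ann}_{r}(xy)\setminus(\mathrm{Ann}_{r}(x)\cup\mathrm{Ann}_{r}(y))\neq\emptyset$. A digraph is connected if for every two distinct vertices $x,y$ there is a directed path from $x$ to $y$. The directed distance from $x$ to $y$ is the length of a shortest directed path from $x$ to $y$ ($\infty$ if none exists), and $\mathrm{Diam}$ is the greatest directed distance between vertices. $\mathrm{Girth}$ is the length of a shortest directed cycle ($\infty$ if none); $x\to y\to x$ with $x\neq y$ is a directed cycle of length $2$. *)

(* Defs.v *)
From mathcomp Require Import all_boot all_order all_algebra.
From mathcomp Require Import boolp classical_sets.

Set Implicit Arguments.
Unset Strict Implicit.
Unset Printing Implicit Defensive.

Import GRing.Theory.
Local Open Scope classical_set_scope.
Local Open Scope ring_scope.

(* Simple digraphs whose vertices form a possibly infinite subset of [T].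
   There are no multiple arcs because [diarc] is a relation. *)
Record digraph (T : eqType) := Digraph {
  vertices : set T;
  diarc : T -> T -> Prop;
  diarc_vertices : forall x y, diarc x y -> vertices x /\ vertices y;
  diarc_irreflexive : forall x, ~ diarc x x }.

Section DigraphInvariants.
Variables (T : eqType) (G : digraph T).

Definition diarcb : rel T := fun x y => `[< diarc G x y >].

(* The directed path is [x :: p], so that its length, the number of arcs, is
   [size p]. *)
Definition dipath (x y : T) (p : seq T) : Prop :=
  [/\ path diarcb x p, uniq (x :: p) & last x p = y].

(* The arc closing up the cycle is included, so the length is [size c]. *)
Definition dicycle (c : seq T) : Prop :=
  [/\ cycle diarcb c, uniq c & (1 < size c)%N].

Definition diconnected : Prop :=
  forall x y, vertices G x -> vertices G y -> x != y -> exists p, dipath x y p.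

End DigraphInvariants.

(* Values in [option nat] are natural numbers extended with infinity, which is
   represented by [None]; in particular the minimum of the empty set is
   infinite. *)
Definition set_min (A : set nat) : option nat :=
  match pselect (exists n, `[< A n >]) with
  | left exA => Some (ex_minn exA)
  | right _ => None
  end.

Section DigraphMetric.
Variables (T : eqType) (G : digraph T).

Definition didist (x y : T) : option nat :=
  set_min [set size p | p in dipath G x y].

(* The supremum of the distances, as the minimum of their finite upper bounds:
   it is infinite if some distance is, or if the distances are unbounded. *)
Definition diam : option nat :=
  set_min [set n | forall x y, vertices G x -> vertices G y ->
                   exists2 d, didist x y = Some d & (d <= n)%N].

Definition girth : option nat := set_min [set size c | c in dicycle G].

End DigraphMetric.

Section ZeroDivisorDigraphs.
Variable R : pzRingType.
Implicit Types x y : R.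

Definition left_zero_divisor x : Prop := exists2 y, y != 0 & x * y = 0.
Definition right_zero_divisor x : Prop := exists2 y, y != 0 & y * x = 0.

Definition zero_divisors : set R :=
  [set x | left_zero_divisor x \/ right_zero_divisor x].

Definition Annl x : set R := [set s | s * x = 0].
Definition Annr x : set R := [set s | x * s = 0].

Definition ezd_arc x y : Prop :=
  [/\ (zero_divisors `\ 0) x, (zero_divisors `\ 0) y, x != y &
      exists k m : nat, [/\ (0 < k)%N, (0 < m)%N, x ^+ k != 0, y ^+ m != 0
                          & x ^+ k * y ^+ m = 0]].

Lemma ezd_arc_vertices x y :
  ezd_arc x y -> (zero_divisors `\ 0) x /\ (zero_divisors `\ 0) y.
Proof. by case. Qed.

Lemma ezd_arc_irreflexive x : ~ ezd_arc x x.
Proof. by case=> _ _; rewrite eqxx. Qed.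

Definition extended_zero_divisor_digraph : digraph R :=
  Digraph ezd_arc_vertices ezd_arc_irreflexive.

Definition ann_arc x y : Prop :=
  [/\ (zero_divisors `\ 0) x, (zero_divisors `\ 0) y, x != y &
      Annl (x * y) `\` (Annl x `|` Annl y) !=set0 \/
      Annr (x * y) `\` (Annr x `|` Annr y) !=set0].

Lemma ann_arc_vertices x y :
  ann_arc x y -> (zero_divisors `\ 0) x /\ (zero_divisors `\ 0) y.
Proof. by case. Qed.

Lemma ann_arc_irreflexive x : ~ ann_arc x x.
Proof. by case=> _ _; rewrite eqxx. Qed.

Definition annihilator_digraph : digraph R :=
  Digraph ann_arc_vertices ann_arc_irreflexive.

End ZeroDivisorDigraphs.

(* Main.v *)
Require Import Defs.
From mathcomp Require Import all_boot all_order all_algebra.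
From mathcomp Require Import boolp classical_sets.

(** In a matrix ring over a field every zero divisor is singular, hence is one
    on both sides, and the ring is prime.  So for nonzero zero divisors [x]
    and [y] one can choose nonzero [a] and [b] with [x * a = 0] and
    [b * y = 0], and then [c] with [z = a * c * b != 0]
    ([common_annihilator]).  This [z] satisfies [x * z = 0 = z * y].  Both
    digraphs have an arc from [x] to [y] as soon as [x * y = 0], so either
    [x -> z -> y], or [z] is [x] or [y] and then [x * y = 0] gives the arc
    [x -> y].  All distances are therefore at most 2.

    The values are attained on matrix units.  The idempotents [E00] and [E11]
    annihilate each other, which gives a directed cycle of length 2.  Put
    [e = E00] and [f = E00 + E01]: these are distinct idempotents with
    [e * f = f].  Powers of [e] and [f] never have zero product, and
    [e * f = f] has the same annihilators as [f], so neither digraph has an arc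
    from [e] to [f], and that distance is exactly 2. *)

Set Implicit Arguments.
Unset Strict Implicit.
Unset Printing Implicit Defensive.

Import GRing.Theory.
Local Open Scope classical_set_scope.
Local Open Scope ring_scope.

(** * Distance, diameter and girth of a digraph *)

Lemma set_min_eq (A : set nat) n :
  A n -> (forall m, A m -> (n <= m)%N) -> set_min A = Some n.
Proof.
move=> An n_le; rewrite /set_min; case: pselect => [exA|[]]; last first.
  by exists n; apply/asboolP.
case: ex_minnP => m /asboolP Am m_le; congr Some; apply/eqP.
by rewrite eqn_leq n_le // m_le //; apply/asboolP.
Qed.

Lemma set_min_le (A : set nat) n :
  A n -> exists2 m, set_min A = Some m & (m <= n)%N.
Proof.
move=> An; rewrite /set_min; case: pselect => [exA|[]]; last first.
  by exists n; apply/asboolP.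
by case: ex_minnP => m _ m_le; exists m => //; apply/m_le/asboolP.
Qed.

Lemma set_min_mem (A : set nat) n : set_min A = Some n -> A n.
Proof.
rewrite /set_min; case: pselect => // exA [<-].
by case: ex_minnP => m /asboolP.
Qed.

Section DiameterAndGirthTwo.
Variables (T : eqType) (G : digraph T).

Lemma diarc_neq x y : diarc G x y -> x != y.
Proof.
by move=> xy; apply/eqP => eq_xy; move: xy; rewrite eq_xy; apply: diarc_irreflexive.
Qed.

Lemma dipath_arc x y : diarc G x y -> dipath G x y [:: y].
Proof.
move=> xy; split=> //=; first by rewrite andbT; apply/asboolP.
by rewrite inE (diarc_neq xy).
Qed.

Lemma dipath_two_arcs x z y :
  x != y -> diarc G x z -> diarc G z y -> dipath G x y [:: z; y].
Proof.
move=> neq_xy xz zy; split=> //=.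
  by rewrite andbT; apply/andP; split; apply/asboolP.
by rewrite !inE negb_or neq_xy (diarc_neq xz) (diarc_neq zy).
Qed.

Lemma dipath_size_ge2 x y p :
  x != y -> ~ diarc G x y -> dipath G x y p -> (2 <= size p)%N.
Proof.
move=> neq_xy xy [+ _]; case: p => [|z [|]] //=.
  by move=> _ eq_xy; rewrite eq_xy eqxx in neq_xy.
by move=> /andP[/asboolP xz _] eq_zy; rewrite eq_zy in xz.
Qed.

Hypothesis short_dipath : forall x y, vertices G x -> vertices G y ->
  x != y -> exists2 p, dipath G x y p & (size p <= 2)%N.

Lemma short_diconnected : diconnected G.
Proof. by move=> x y Gx Gy /(short_dipath Gx Gy)[p]; exists p. Qed.

Lemma diam_two x0 y0 : vertices G x0 -> vertices G y0 ->
  x0 != y0 -> ~ diarc G x0 y0 -> diam G = Some 2%N.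
Proof.
move=> Gx0 Gy0 neq_xy0 no_xy0; apply: set_min_eq => [x y Gx Gy|n n_ub].
  have [p xy_p le_p2] : exists2 p, dipath G x y p & (size p <= 2)%N.
    by have [->|/(short_dipath Gx Gy)//] := eqVneq x y; exists [::].
  have [|d dE le_dp] := @set_min_le [set size p | p in dipath G x y] (size p).
    by exists p.
  by exists d => //; apply: leq_trans le_p2.
have [d /set_min_mem[p xy_p <-]] := n_ub _ _ Gx0 Gy0.
by apply: leq_trans; apply: dipath_size_ge2 xy_p.
Qed.

Lemma girth_two x y : diarc G x y -> diarc G y x -> girth G = Some 2%N.
Proof.
move=> xy yx; apply: set_min_eq => [|_ [c [_ _ ?] <-] //].
exists [:: x; y] => //; split=> //=; last by rewrite inE (diarc_neq xy).
by rewrite andbT; apply/andP; split; apply/asboolP.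
Qed.

End DiameterAndGirthTwo.

(** * Zero-divisor digraphs of a ring *)

Section RingDigraphs.
Variable R : pzRingType.
Implicit Types (x y e f : R) (G : digraph R).

Lemma mul0_vertices x y : x != 0 -> y != 0 -> x * y = 0 ->
  (@zero_divisors R `\ 0) x /\ (@zero_divisors R `\ 0) y.
Proof.
by move=> x0 y0 xy0; split; split; [left; exists y|apply/eqP|right; exists x|apply/eqP].
Qed.

Lemma ezd_arc_mul0 x y : x != 0 -> y != 0 -> x != y -> x * y = 0 -> ezd_arc x y.
Proof.
move=> x0 y0 neq_xy xy0; have [Zx Zy] := mul0_vertices x0 y0 xy0.
by split=> //; exists 1%N, 1%N; split; rewrite ?expr1.
Qed.

(** When the product vanishes its annihilator is the whole ring, and 1 lies in
    the annihilator of no nonzero element. *)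
Lemma ann_arc_mul0 x y : x != 0 -> y != 0 -> x != y -> x * y = 0 -> ann_arc x y.
Proof.
move=> x0 y0 neq_xy xy0; have [Zx Zy] := mul0_vertices x0 y0 xy0.
split=> //; left; exists 1; split; first by rewrite /Annl /= mul1r.
by rewrite /Annl /= !mul1r => -[] /eqP; apply/negP.
Qed.

Lemma idempotent_exprS e k : e * e = e -> e ^+ k.+1 = e.
Proof. by move=> ee; elim: k => [|k IHk]; rewrite ?expr1 // exprS IHk. Qed.

Lemma idempotent_no_ezd_arc e f :
  e * e = e -> f * f = f -> e * f = f -> ~ ezd_arc e f.
Proof.
move=> ee ff ef [_ [_ f0] _] [[|k] [[|m] [//]]] _ _ _ _.
by rewrite !idempotent_exprS // ef.
Qed.

Lemma mul_id_no_ann_arc e f : e * f = f -> ~ ann_arc e f.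
Proof. by move=> ef [_ _ _]; rewrite ef => -[] [s [sf []]]; right. Qed.

Hypothesis prime_R : forall a b : R, a != 0 -> b != 0 -> exists c, a * c * b != 0.
Hypothesis two_sided : forall x, zero_divisors x ->
  left_zero_divisor x /\ right_zero_divisor x.

Lemma common_annihilator x y : zero_divisors x -> zero_divisors y ->
  exists z, [/\ z != 0, x * z = 0 & z * y = 0].
Proof.
move=> /two_sided[[a a0 xa] _] /two_sided[_ [b b0 yb]].
have [c z0] := prime_R a0 b0; exists (a * c * b); split=> //.
  by rewrite !mulrA xa !mul0r.
by rewrite -mulrA yb mulr0.
Qed.

Lemma mul0_arcs_short_dipath G :
    vertices G = @zero_divisors R `\ 0 ->
    (forall x y, x != 0 -> y != 0 -> x != y -> x * y = 0 -> diarc G x y) ->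
  forall x y, vertices G x -> vertices G y -> x != y ->
  exists2 p, dipath G x y p & (size p <= 2)%N.
Proof.
move=> -> arc0 x y [Zx /eqP x0] [Zy /eqP y0] neq_xy.
have [z [z0 xz zy]] := common_annihilator Zx Zy.
have [xy0|xy0] := eqVneq (x * y) 0.
  by exists [:: y] => //; apply: dipath_arc; apply: arc0.
exists [:: z; y] => //; apply: dipath_two_arcs => //; apply: arc0 => //.
  by apply: contra_neq xy0 => ->.
by apply: contra_neq xy0 => <-.
Qed.

End RingDigraphs.

(** * Matrix rings over a field *)

Section MatrixRing.
Variables (F : fieldType) (n : nat).
Implicit Types A B : 'M[F]_n.

Lemma matrix_neq0P m p (A : 'M[F]_(m, p)) : A != 0 -> exists i j, A i j != 0.
Proof.
move=> A0; apply: contrapT => noA; case/eqP: A0; apply/matrixP => i j.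
by rewrite mxE; apply: contrapT => /eqP Aij; apply: noA; exists i, j.
Qed.

Lemma matrix_prime A B : A != 0 -> B != 0 -> exists C : 'M[F]_n, A * C * B != 0.
Proof.
move=> /matrix_neq0P[i [j Aij]] /matrix_neq0P[k [l Bkl]].
(* The [(i, l)] entry of [A * E_jk * B] is [A i j * B k l]. *)
exists (delta_mx j k); apply/eqP => /matrixP/(_ i l)/eqP; apply/negP.
rewrite -(mul_delta_mx (0 : 'I_1)) -!mulmxE mulmxA -colE -mulmxA -rowE.
by rewrite !mxE big_ord1 !mxE mulf_neq0.
Qed.

Lemma matrix_zero_divisor_singular A : zero_divisors A -> A \notin unitmx.
Proof.
move=> [] [B B0 AB]; apply: contra_neqN B0 => uA.
  by rewrite -(mulKmx uA B) mulmxE AB mulr0.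
by rewrite -(mulmxK uA B) mulmxE AB mul0r.
Qed.

Lemma matrix_zero_divisor_two_sided A : zero_divisors A ->
  left_zero_divisor A /\ right_zero_divisor A.
Proof.
move=> /matrix_zero_divisor_singular sA; split.
  exists (cokermx A); last exact: mulmx_coker.
  by apply: contraNneq sA => /eqP; rewrite cokermx_eq0 row_full_unit.
exists (kermx A); last exact: mulmx_ker.
by apply: contraNneq sA => /eqP; rewrite kermx_eq0 row_free_unit.
Qed.

End MatrixRing.

Lemma delta_mx_neq0 (F : fieldType) m n (i : 'I_m) (j : 'I_n) :
  delta_mx i j != 0 :> 'M[F]_(m, n).
Proof.
by apply/eqP => /matrixP/(_ i j)/eqP; rewrite !mxE !eqxx oner_eq0.
Qed.

(** The extended zero-divisor digraph and the annihilator digraph are treated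
    at once, through the two facts about arcs that they share.  The witnesses
    are the matrix units [E00], [E01] and [E11]. *)
Lemma matrix_digraph_diam_girth (F : fieldType) n (G : digraph 'M[F]_n) :
    (2 <= n)%N -> vertices G = @zero_divisors 'M[F]_n `\ 0 ->
    (forall x y : 'M[F]_n,
      x != 0 -> y != 0 -> x != y -> x * y = 0 -> diarc G x y) ->
    (forall e f : 'M[F]_n,
      e * e = e -> f * f = f -> e * f = f -> ~ diarc G e f) ->
  [/\ diconnected G, diam G = Some 2%N & girth G = Some 2%N].
Proof.
case: n G => [|[|n]] // G _ VG arc0 no_arc.
have short := mul0_arcs_short_dipath (@matrix_prime F _)
  (@matrix_zero_divisor_two_sided F _) VG arc0.
pose E i j : 'M[F]_n.+2 := delta_mx i j.
pose i0 : 'I_n.+2 := 0; pose i1 : 'I_n.+2 := 1.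
have EE i j k l : E i j * E k l = E i l *+ (j == k).
  by rewrite -mulmxE mul_delta_mx_cond.
have E0 i j : E i j != 0 by apply: delta_mx_neq0.
pose e := E i0 i0; pose f := e + E i0 i1.
have ee : e * e = e by rewrite EE.
have ef : e * f = f by rewrite mulrDr !EE.
have ff : f * f = f by rewrite mulrDl ef mulrDr !EE !mulr0n !addr0.
have fe : f * e = e by rewrite mulrDl !EE !mulr0n !addr0.
have neq_ef : e != f by rewrite -subr_eq0 opprD addrA subrr add0r oppr_eq0.
have e0 : e != 0 := E0 i0 i0.
have f0 : f != 0 by apply: contra_neq e0 => f0; rewrite -fe f0 mul0r.
have [Ve _] : vertices G e /\ vertices G (E i1 i1).
  by rewrite VG; apply: mul0_vertices; rewrite ?EE.
have [_ Vf] : vertices G (E i1 i1) /\ vertices G f.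
  by rewrite VG; apply: mul0_vertices; rewrite // mulrDr !EE !mulr0n addr0.
split; first exact: short_diconnected.
  by apply: (diam_two short Ve Vf neq_ef); apply: no_arc.
have neq01 : e != E i1 i1.
  by apply: contra_neq e0 => e11; rewrite -ee {2}e11 EE.
apply: (@girth_two _ G e (E i1 i1)); apply: arc0; rewrite ?EE //.
by rewrite eq_sym.
Qed.

Theorem corollary6p7 (F : fieldType) (n : nat) (hn : (2 <= n)%N) :
  [/\ diconnected (extended_zero_divisor_digraph 'M[F]_n),
      diam (extended_zero_divisor_digraph 'M[F]_n) = Some 2%N &
      girth (extended_zero_divisor_digraph 'M[F]_n) = Some 2%N] /\
  [/\ diconnected (annihilator_digraph 'M[F]_n),
      diam (annihilator_digraph 'M[F]_n) = Some 2%N &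
      girth (annihilator_digraph 'M[F]_n) = Some 2%N].
Proof.
split; apply: matrix_digraph_diam_girth => //.
- exact: ezd_arc_mul0.
- exact: idempotent_no_ezd_arc.
- exact: ann_arc_mul0.
- by move=> e f _ _; apply: mul_id_no_ann_arc.
Qed.
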